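(* Let $\mathcal{G}$ be an ultragraph with boundary ultrapath space $X$. The collection of cylinders $$\{D_{(\beta,B)}:(\beta,B)\in\mathfrak{p},\ |\beta|\geq 1\}\cup\{D_{(\beta,B),F,S}:(\beta,B)\in X_{fin},\ F\subseteq\varepsilon(B),\ S\subseteq B\cap G^0_s,\ |F|,|S|<\infty\}$$ is a countable basis for a topology on $X$. Furthermore, if $\gamma=e_1e_2\ldots\in\mathfrak{p}^\infty$, then a neighborhood basis for $\gamma$ is given by $\{D_{(e_1\ldots e_n,r(e_n))}:n\in\mathbb{N},\ n\ge 1\}$, and if $x=(\alpha,A)\in X_{fin}$ is such that $A$ is a minimal infinite emitter or a minimal sink, then a neighborhood basis for $x$ is given by $\{D_{(\alpha,A),F,S}:F\subseteq\varepsilon(A),\ S\subseteq A\cap G^0_s,\ |F|,|S|<\infty\}$.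
   Context: An ultragraph $\mathcal{G}=(G^0,\mathcal{G}^1,r,s)$ consists of countable sets $G^0$ (vertices) and $\mathcal{G}^1$ (edges) and maps $s:\mathcal{G}^1\to G^0$, $r:\mathcal{G}^1\to P(G^0)\setminus\{\emptyset\}$. $\mathcal{G}^0$ (generalized vertices) is the smallest subset of $P(G^0)$ containing $\{v\}$ for all $v\in G^0$ and $r(e)$ for all $e\in\mathcal{G}^1$, and closed under finite unions and nonempty finite intersections. For $A\in\mathcal{G}^0$, $\varepsilon(A)=\{e\in\mathcal{G}^1:s(e)\in A\}$; $A$ is an infinite emitter if $|\varepsilon(A)|=\infty$ and a finite emitter otherwise. A vertex $v$ is a sink if $s^{-1}(v)=\emptyset$; $G^0_s$ is the set of sinks. $A\in\mathcal{G}^0$ is a minimal infinite emitter if it is an infinite emitter and no proper subset $B\in\mathcal{G}^0$ of $A$ is an infinite emitter or a finite emitter with $|B|=\infty$. $A\in\mathcal{G}^0$ is a minimal sink if $|A|=\infty$, $|\varepsilon(A)|<\infty$ and no proper subset $B\in\mathcal{G}^0$ of $A$ is infinite. A finite path of length $n\ge1$ is $\alpha=e_1\ldots e_n$ with $e_i\in\mathcal{G}^1$, $s(e_{i+1})\in r(e_i)$; $s(\alpha)=s(e_1)$, $r(\alpha)=r(e_n)$. An ultrapath of length $n\ge 1$ is a pair $(\alpha,A)$ with $\alpha$ a finite path of length $n$, $A\in\mathcal{G}^0$, $A\subseteq r(\alpha)$; an ultrapath of length $0$ is an $A\in\mathcal{G}^0$, also written $(A,A)$, with $s(A)=r(A)=A$.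 $\mathfrak{p}$ is the set of all ultrapaths; $\mathfrak{p}^\infty$ is the set of infinite paths $e_1e_2\ldots$ with $s(e_{i+1})\in r(e_i)$. $|x|$ denotes length. $X_{fin}$ is the set of ultrapaths $(\alpha,A)$ of length $\geq 0$ (meaning $(A,A)$ for length $0$) such that $A$ is a minimal infinite emitter, or a minimal sink, or $A=\{v\}$ with $v$ a sink; $X_{sin}\subseteq X_{fin}$ consists of those for which $A$ is a minimal sink or $A=\{v\}$ with $v$ a sink. The boundary ultrapath space is $X=\mathfrak{p}^\infty\sqcup X_{fin}$. Cylinders: for $(\beta,B)\in\mathfrak{p}$, $D_{(\beta,B)}=\{y\in X: y=\beta\gamma,\ s(\gamma)\in B\}$, i.e. $\gamma$ runs over infinite paths or ultrapaths starting in $B$, where for $\gamma$ of length $0$ (so $\gamma=(C,C)$, $y=(\beta,C)$) the condition reads $C\subseteq B$; when $|\beta|=0$, $(\beta,B)=(B,B)$ and $\beta\gamma=\gamma$. For $(\beta,B)\in X_{fin}$, $F\subseteq\varepsilon(B)$ finite and $S\subseteq B\cap G^0_s$ finite, $$D_{(\beta,B),F,S}=\{(\beta,B)\}\cup\{y\in X:y=\beta\gamma',\ |\gamma'|\ge1,\ \gamma'_1\in\varepsilon(B)\setminus F\}\cup\{(\beta,\{v\})\in X_{sin}: v\in B\setminus S\},$$ where $\gamma'_1$ is the first edge of $\gamma'$ (for $|\beta|=0$, $(\beta,\{v\})$ means $(\{v\},\{v\})$). *)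

(* Defs.v *)
From HB Require Import structures.
From mathcomp Require Import all_boot.
From mathcomp Require Import boolp classical_sets functions cardinality filter.
From mathcomp Require Import topology.

Set Implicit Arguments.
Unset Strict Implicit.
Unset Printing Implicit Defensive.

Local Open Scope classical_set_scope.

(* A topology on X, presented by its open sets; the last two arguments are the
   choice and equality structures of X. *)
Notation topology_on X :=
  (isOpenTopological.axioms_ (Choice.sort X)
    (Choice.choice_hasChoice_mixin (Choice.class X))
    (Choice.eqtype_hasDecEq_mixin (Choice.class X))).

Definition topological_on (X : choiceType) (m : topology_on X) :
  topologicalType := HB.pack (Choice.sort X) m.

Definition nbhs_basis (T : topologicalType) (x : T) (N : set (set T)) : Prop :=
  N `<=` nbhs x /\ filter_from N id --> x.

Record ultragraph := Ultragraph {
  vertex : countType;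
  edge : countType;
  src : edge -> vertex;
  rng : edge -> set vertex;
  rng_neq0 : forall e, rng e !=set0 }.

Section Ultragraph.
Context (G : ultragraph).
Local Notation V := (vertex G).
Local Notation E := (edge G).

(* As ranges are nonempty and only nonempty intersections are taken, set0 is
   not a generalized vertex. *)
Definition closed_UI (M : set (set V)) : Prop :=
  (forall A B, M A -> M B -> M (A `|` B)) /\
  (forall A B, M A -> M B -> A `&` B !=set0 -> M (A `&` B)).

Definition gen_vertex : set (set V) :=
  smallest closed_UI (range (fun v : V => [set v]) `|` range (@rng G)).

Definition emitted (A : set V) : set E := [set e | A (src e)].

Definition infinite_emitter (A : set V) : Prop := infinite_set (emitted A).

Definition finite_emitter (A : set V) : Prop := finite_set (emitted A).

Definition sinks : set V := [set v | @src G @^-1` [set v] = set0].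

Definition minimal_infinite_emitter (A : set V) : Prop :=
  [/\ gen_vertex A, infinite_emitter A &
      forall B, gen_vertex B -> B `<` A ->
        ~ (infinite_emitter B \/ (finite_emitter B /\ infinite_set B))].

Definition minimal_sink (A : set V) : Prop :=
  [/\ gen_vertex A, infinite_set A, finite_emitter A &
      forall B, gen_vertex B -> B `<` A -> ~ infinite_set B].

Definition sink_singleton (A : set V) : Prop :=
  exists2 v, sinks v & A = [set v].

Definition finite_path (p : seq E) : Prop :=
  sorted (fun e f => src f \in rng e) p.

Definition infinite_path : set (nat -> E) :=
  [set g | forall i, rng (g i) (src (g i.+1))].

(* The pair (alpha, A) represents an ultrapath; those of length 0, written
   A or (A, A) in the literature, are the pairs ([::], A). *)
Definition ultrapath : set (seq E * set V) :=
  [set u | [/\ finite_path u.1, gen_vertex u.2 &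
    if u.1 is e :: p then u.2 `<=` rng (last e p) else True]].

Definition X_fin : set (seq E * set V) :=
  [set u | ultrapath u /\
    [\/ minimal_infinite_emitter u.2, minimal_sink u.2 | sink_singleton u.2]].

Definition X_sin : set (seq E * set V) :=
  [set u | X_fin u /\ (minimal_sink u.2 \/ sink_singleton u.2)].

(* No path condition is imposed here; see all_paths and boundary. *)
Definition prepath : Type := ((nat -> E) + (seq E * set V))%type.

Definition all_paths : set prepath :=
  inl @` infinite_path `|` inr @` ultrapath.

Definition boundary : set prepath := inl @` infinite_path `|` inr @` X_fin.

Definition boundary_space : choiceType := set_type boundary.

Definition path_of (y : boundary_space) : prepath := val y.

Fixpoint prepend (b : seq E) (g : nat -> E) : nat -> E :=
  if b is e :: b' then fun i => if i is j.+1 then prepend b' g j else e else g.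

Definition concat (b : seq E) (y : prepath) : prepath :=
  match y with
  | inl g => inl (prepend b g)
  | inr u => inr (b ++ u.1, u.2)
  end.

Definition first_edge (y : prepath) : option E :=
  match y with
  | inl g => Some (g 0)
  | inr u => ohead u.1
  end.

(* s(y) \in B, which reads C `<=` B when y = (C, C) has length 0 *)
Definition starts_in (y : prepath) (B : set V) : Prop :=
  match y with
  | inl g => B (src (g 0))
  | inr (e :: _, _) => B (src e)
  | inr ([::], C) => C `<=` B
  end.

Definition cylinder (u : seq E * set V) : set boundary_space :=
  [set y | exists c : prepath,
    [/\ all_paths c, starts_in c u.2 & path_of y = concat u.1 c]].

(* [first_edge c = Some e] encodes that c has length at least 1 and that its
   first edge is e. *)
Definition fin_cylinder (u : seq E * set V) (F : set E) (S : set V) :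
    set boundary_space :=
  [set y | path_of y = inr u] `|`
  [set y | exists c e, [/\ all_paths c, first_edge c = Some e,
                           (emitted u.2 `\` F) e & path_of y = concat u.1 c]] `|`
  [set y | exists v, [/\ X_sin (u.1, [set v]), (u.2 `\` S) v &
                         path_of y = inr (u.1, [set v])]].

Definition fin_cylinders_at (u : seq E * set V) : set (set boundary_space) :=
  [set D | exists F S,
    [/\ F `<=` emitted u.2, S `<=` u.2 `&` sinks, finite_set F, finite_set S &
        D = fin_cylinder u F S]].

Definition cylinders : set (set boundary_space) :=
  [set cylinder u | u in [set u | ultrapath u /\ (1 <= size u.1)%N]] `|`
  \bigcup_(u in X_fin) fin_cylinders_at u.

(* Edges are indexed from 0: e_(i+1) is g i. *)
Definition initial_cylinders (g : nat -> E) : set (set boundary_space) :=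
  [set cylinder (mkseq g n, rng (g n.-1)) | n in [set n | (1 <= n)%N]].

End Ultragraph.

Arguments cylinders G : clear implicits.

(* Main.v *)
Require Import Defs.
From HB Require Import structures.
From mathcomp Require Import all_boot.
From mathcomp Require Import boolp classical_sets functions cardinality filter.
From mathcomp Require Import topology.

(** The point is to find, at each boundary path [x], a family of cylinders
   around [x] that refines every cylinder containing [x] and is directed
   downwards. This one local fact yields at once that cylinders
   form a basis and that the refining family is a neighborhood basis of [x]
   ([topology_from_local_bases]). The family is [initial_cylinders g] when [x]
   is an infinite path [g], and [fin_cylinders_at u] when [x] is an ultrapath
   [u].

   Everything rests on how a cylinder [D] can contain [x]
   ([cylinders_inv]). Let [b] be the word that defines [D]. If [x] continues
   [b] with an edge [e], then [D] contains every boundary path that extends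
   [b e], hence all those that share with [x] a long enough prefix. This is the
   only possibility for an infinite path, and it settles that case; it also
   settles the case of an ultrapath [(a, A)] whose word [a] extends [b e], as
   all points of [D_{(a,A),F,S}] extend [a]. Otherwise [x = (b, A)] has the
   same word as [D]. Then [D] is the cylinder of some [(b, B)] with [A] inside
   [B], and contains all the [D_{(b,A),F,S}]; or [D] is itself one of these
   cylinders; or [x] belongs to [D] as one of its points [(b, {v})] of
   [X_sin]. In the last case [v] is a sink, since a minimal sink is infinite,
   and [x] is isolated: every [D_{(b,{v}),F,S}] is reduced to [x]
   ([fin_cylinder_sink]).

   Countability holds because a generalized vertex is the value of a finite
   expression in unions and intersections of the countably many generators. *)

Set Implicit Arguments.
Unset Strict Implicit.
Unset Printing Implicit Defensive.

Local Open Scope classical_set_scope.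

(** * Topologies defined by local bases *)

(** The open sets are those containing, with each point [x], a member of
   [L x]. As [L x] consists of members of [C] and refines finite intersections
   of members of [C], both [C] and the [L x] are bases of that topology. *)
Lemma topology_from_local_bases (X : choiceType) (C : set (set X))
    (L : X -> set (set X)) :
  (forall x N, L x N -> C N /\ N x) ->
  (forall x, L x !=set0) ->
  (forall x D1 D2, C D1 -> C D2 -> D1 x -> D2 x ->
     exists2 N, L x N & N `<=` D1 `&` D2) ->
  exists m : topology_on X,
    @basis (topological_on m) C /\
    forall x : topological_on m, nbhs_basis x (L x).
Proof.
move=> LC L0 CI.
pose op (U : set X) := forall x, U x -> exists2 N, L x N & N `<=` U.
have opT : op setT by move=> x _; have [N LN] := L0 x; exists N.
have opI : setI_closed op.
  move=> A B oA oB x [/oA[N1 L1 sA] /oB[N2 L2 sB]].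
  have [[C1 x1] [C2 x2]] := (LC _ _ L1, LC _ _ L2).
  have [N LN sN] := CI _ _ _ C1 C2 x1 x2.
  by exists N => // y /sN[/sA ? /sB ?].
have opU I (f : I -> set X) : (forall i, op (f i)) -> op (\bigcup_i f i).
  move=> of_ x [i _ /of_[N LN sN]]; exists N => // y /sN ?; by exists i.
have opC D : C D -> op D.
  by move=> CD x Dx; have [N LN sN] := CI _ _ _ CD CD Dx Dx;
    exists N => // y /sN[].
pose m : topology_on X := isOpenTopological.Axioms_ op opT opI opU.
have openC D : C D -> @open (topological_on m) D by exact: opC.
have nbL (x : topological_on m) : nbhs_basis x (L x).
  split.
    move=> N /LC[CN Nx]; rewrite nbhsE; exists N => //.
    by split => //; exact: openC.
  move=> U; rewrite nbhsE => -[B [oB Bx] sBU].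
  have oB' : op B := oB.
  have [N LN sN] := oB' _ Bx.
  by exists N => //; exact: subset_trans sBU.
exists m; split => //; split=> [D /openC //|x U /(proj2 (nbL x))[N LN sN]].
by exists N => //; exact: LC.
Qed.

Section UltragraphTheory.
Context (G : ultragraph).
Local Notation V := (vertex G).
Local Notation E := (edge G).
Implicit Types (b p : seq E) (g : nat -> E) (c : prepath G).
Implicit Types (x y : boundary_space G) (D : set (boundary_space G)).

(** * Concatenation of paths *)

Lemma prepend_cat b p g : prepend (b ++ p) g = prepend b (prepend p g).
Proof. by elim: b => //= e b ->. Qed.

Lemma concat_cat b p c : concat (b ++ p) c = concat b (concat p c).
Proof. by case: c => [g|u] /=; rewrite (prepend_cat, catA). Qed.

Lemma prepend_addn b g i : prepend b g (size b + i) = g i.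
Proof. by elim: b => //= e b; rewrite addSn. Qed.

Lemma mkseqSl (T : Type) (f : nat -> T) n :
  mkseq f n.+1 = f 0 :: mkseq (f \o S) n.
Proof. by rewrite /mkseq /= (iotaDl 1 0) -map_comp. Qed.

Lemma mkseq_prepend b g : mkseq (prepend b g) (size b) = b.
Proof.
by elim: b => //= e b IH; rewrite mkseqSl; congr cons; rewrite -[RHS]IH.
Qed.

Lemma prepend_mkseq g n : prepend (mkseq g n) (fun i => g (n + i)) = g.
Proof.
elim: n g => [|n IH] g //; rewrite mkseqSl.
by apply/funext => -[|i] //=; rewrite -[RHS](congr1 (@^~ i) (IH (g \o S))).
Qed.

Lemma mkseq_prefix g n m : n <= m ->
  mkseq g m = mkseq g n ++ drop n (mkseq g m).
Proof.
move=> le_nm; rewrite -{1}(cat_take_drop n (mkseq g m)).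
by rewrite -map_take take_iota (minn_idPl le_nm).
Qed.

(** Thanks to this, the path conditions in the definition of the cylinders hold
   automatically for the suffixes of a boundary path, so that membership in a
   cylinder only depends on prefixes. *)
Lemma all_paths_suffix b c : all_paths (concat b c) -> all_paths c.
Proof.
case: c => [g|[p A]] [] [z zP] //= [zE].
- left; exists g => // i; have := zP (size b + i).
  by rewrite zE -addnS !prepend_addn.
- right; exists (p, A) => //; move: zP; rewrite {}zE => -[/= bpP AG Asub].
  split=> //=; first by case: (cat_sorted2 bpP).
  case: p {bpP} Asub => //= e p.
  by case: b => //= f b; rewrite last_cat.
Qed.

Lemma path_of_all_paths x : all_paths (path_of x).
Proof.
by case: (set_valP x) => -[z zP zE]; [left|right]; exists z => //; case: zP.
Qed.

Lemma path_of_suffix x b c : path_of x = concat b c -> all_paths c.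
Proof. by move=> xE; apply: (@all_paths_suffix b); rewrite -xE;
  exact: path_of_all_paths. Qed.

Lemma path_of_X_fin x u : path_of x = inr u -> X_fin u.
Proof.
by rewrite /path_of; case: (set_valP x) => -[z zP <-] // [<-].
Qed.

Lemma path_of_infinite x g : path_of x = inl g -> infinite_path g.
Proof.
by rewrite /path_of; case: (set_valP x) => -[z zP <-] // [<-].
Qed.

Definition extensions b : set (boundary_space G) :=
  [set y | exists c, path_of y = concat b c].

Lemma extensions_cat b p : extensions (b ++ p) `<=` extensions b.
Proof. by move=> y [c yE]; exists (concat p c); rewrite -concat_cat. Qed.

(** * Cylinders *)

Lemma cylinderI x u c : starts_in c u.2 -> path_of x = concat u.1 c ->
  cylinder u x.
Proof. by move=> cu xE; exists c; split=> //; exact: path_of_suffix xE. Qed.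

Lemma cylinder_extensions u : cylinder u `<=` extensions u.1.
Proof. by move=> y [c [_ _ yE]]; exists c. Qed.

Lemma fin_cylinder_edge x u (F : set E) (S : set V) e c :
  (emitted u.2 `\` F) e -> path_of x = concat (rcons u.1 e) c ->
  fin_cylinder u F S x.
Proof.
move=> eF; rewrite -cats1 concat_cat => xE; left; right.
exists (concat [:: e] c), e; split=> //; first exact: path_of_suffix xE.
by case: (c).
Qed.

Lemma fin_cylinder_extensions u F S : @fin_cylinder G u F S `<=` extensions u.1.
Proof.
move=> y [[/= yE|[c [e [_ _ _ yE]]]]|[v [_ _ yE]]].
- by exists (inr ([::], u.2)); rewrite /= cats0 yE; case: (u).
- by exists c.
- by exists (inr ([::], [set v])); rewrite /= cats0.
Qed.

Lemma fin_cylinder_subset u (F F' : set E) (S S' : set V) :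
  F' `<=` F -> S' `<=` S -> fin_cylinder u F S `<=` fin_cylinder u F' S'.
Proof.
move=> sF sS y [[yE|[c [e [cP ce [eu eF] yE]]]]|[v [vX [uv Sv] yE]]].
- by left; left.
- by left; right; exists c, e; split=> //; split=> // /sF.
- by right; exists v; split=> //; split=> // /sS.
Qed.

Lemma fin_cylinder_subset_cylinder b (A B : set V) F S : A `<=` B ->
  fin_cylinder (b, A) F S `<=` cylinder (b, B).
Proof.
move=> sAB y [[/= yE|[c [e [cP ce [eu eF] yE]]]]|[v [vX [uv Sv] yE]]].
- by apply: (@cylinderI _ _ (inr ([::], A))) => //=; rewrite cats0.
- apply: (@cylinderI y (b, B) c _ yE).
  case: c ce {cP yE} => [g|[[|f p] C]] //= [fe].
  + by rewrite fe; exact: sAB.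
  + by rewrite fe; exact: sAB.
- apply: (@cylinderI _ _ (inr ([::], [set v]))) => /=; last by rewrite cats0.
  by move=> _ ->; exact: sAB.
Qed.

Lemma first_edgeP c e : first_edge c = Some e ->
  exists c', c = concat [:: e] c'.
Proof.
case: c => [g|[[|f p] C]] //= [<-]; last by exists (inr (p, C)).
by exists (inl (g \o S)); congr inl; apply/funext => -[].
Qed.

Variant cylinder_entry x D : Prop :=
| EntryEdge b e c of path_of x = concat (rcons b e) c
    & extensions (rcons b e) `<=` D
| EntrySubset b (A B : set V) of path_of x = inr (b, A) & A `<=` B
    & D = cylinder (b, B)
| EntryCenter u of path_of x = inr u & fin_cylinders_at u D
| EntrySingleton b v of path_of x = inr (b, [set v]) & X_sin (b, [set v]).

(** The distinction is whether the part of the path that follows the word of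
   the cylinder has a first edge or has length 0. *)
Lemma cylinders_inv x D : cylinders G D -> D x -> cylinder_entry x D.
Proof.
case=> [[[b B] [_ _] <-]|[u uX [F [S [FE SE Ff Sf ->]]]]].
- case=> c [/= cP cB xE].
  have edge e c' : B (src e) -> c = concat [:: e] c' ->
      cylinder_entry x (cylinder (b, B)).
    move=> eB cE; apply: (@EntryEdge _ _ b e c').
      by rewrite -cats1 concat_cat -cE.
    move=> y [c0]; rewrite -cats1 concat_cat => yE.
    by apply: (@cylinderI y (b, B) _ _ yE); case: c0 {yE}.
  case: c cB cP xE edge => [g|[[|e p] A]] cB _ xE edge.
  + have [c' cE] := @first_edgeP (inl g) (g 0) erefl.
    exact: edge cB cE.
  + by apply: (@EntrySubset _ _ b A B) => //; rewrite xE /= cats0.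
  + have [c' cE] := @first_edgeP (inr (e :: p, A)) e erefl.
    exact: edge cB cE.
- case=> [[/= xE|[c [e [_ /first_edgeP[c' ->] eF xE]]]]|[v [vX _ xE]]].
  + by apply: EntryCenter xE _; exists F, S.
  + apply: (@EntryEdge _ _ u.1 e c').
      by rewrite -cats1 concat_cat.
    by move=> y [c0]; apply: fin_cylinder_edge.
  + exact: EntrySingleton xE vX.
Qed.

(** * Local bases at infinite paths *)

Lemma initial_cylinders_sub x g N : path_of x = inl g ->
  initial_cylinders g N -> cylinders G N /\ N x.
Proof.
move=> xE [n /= n0 <-]; have gP := path_of_infinite xE; split.
  left; exists (mkseq g n, rng (g n.-1)) => //; split; last first.
    by rewrite /= size_mkseq.
  split=> /=.
  - apply/(sortedP (g 0)) => i; rewrite size_mkseq => ltin.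
    by rewrite !nth_mkseq ?(ltnW ltin)//; apply/mem_set/gP.
  - by apply: sub_gen_smallest; right; exists (g n.-1).
  - case: n n0 => // n _; case nE: (mkseq g n.+1) => [|e p] //.
    by rewrite -(last_cons e) -nE -nth_last size_mkseq nth_mkseq.
apply: (@cylinderI _ _ (inl (fun i => g (n + i)))) => /=.
  by rewrite addn0; case: n n0 => // n _; exact: gP.
by rewrite prepend_mkseq.
Qed.

(** An infinite path can only enter a cylinder through an edge, so that the
   cylinder depends on finitely many of its edges. *)
Lemma infinite_path_absorb x g D : path_of x = inl g ->
  cylinders G D -> D x -> exists n, extensions (mkseq g n) `<=` D.
Proof.
move=> xE CD Dx; case: (cylinders_inv CD Dx).
- move=> b e [h|u]; rewrite xE // => -[gE] sD.
  by exists (size (rcons b e)); rewrite gE mkseq_prepend.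
- by move=> b A B; rewrite xE.
- by move=> u; rewrite xE.
- by move=> b v; rewrite xE.
Qed.

Lemma initial_cylinders_refine x g D1 D2 : path_of x = inl g ->
  cylinders G D1 -> cylinders G D2 -> D1 x -> D2 x ->
  exists2 N, initial_cylinders g N & N `<=` D1 `&` D2.
Proof.
move=> xE C1 C2 x1 x2.
have [n1 s1] := infinite_path_absorb xE C1 x1.
have [n2 s2] := infinite_path_absorb xE C2 x2.
pose n := (maxn n1 n2).+1.
exists (cylinder (mkseq g n, rng (g n.-1))); first by exists n.
apply: (subset_trans (@cylinder_extensions _)) => /= y.
have [le1 le2] : n1 <= n /\ n2 <= n.
  by rewrite /n !leqW ?leq_maxl ?leq_maxr.
move=> yn; split.
- by apply: s1; move: yn; rewrite (mkseq_prefix g le1); exact: extensions_cat.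
- by apply: s2; move: yn; rewrite (mkseq_prefix g le2); exact: extensions_cat.
Qed.

(** * Local bases at ultrapaths *)

Lemma fin_cylinders_at_sub x u N : path_of x = inr u ->
  fin_cylinders_at u N -> cylinders G N /\ N x.
Proof.
move=> xE uN; split; first by right; exists u => //; exact: path_of_X_fin xE.
by case: uN => F [S [_ _ _ _ ->]]; left; left.
Qed.

Lemma fin_cylinders_at0 u : @fin_cylinders_at G u (fin_cylinder u set0 set0).
Proof. by exists set0, set0; split=> //; exact: sub0set. Qed.

Lemma fin_cylinders_at_refine u N1 N2 :
  fin_cylinders_at u N1 -> fin_cylinders_at u N2 ->
  exists2 N, @fin_cylinders_at G u N & N `<=` N1 `&` N2.
Proof.
move=> [F1 [S1 [F1u S1u F1f S1f ->]]] [F2 [S2 [F2u S2u F2f S2f ->]]].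
exists (fin_cylinder u (F1 `|` F2) (S1 `|` S2)).
  exists (F1 `|` F2), (S1 `|` S2); split => //; try by rewrite finite_setU.
  - by move=> e [/F1u|/F2u].
  - by move=> v [/S1u|/S2u].
rewrite subsetI; split; apply: fin_cylinder_subset.
- exact: subsetUl.
- exact: subsetUl.
- exact: subsetUr.
- exact: subsetUr.
Qed.

Lemma path_of_inj : injective (@path_of G).
Proof. exact: val_inj. Qed.

(** A sink emits no edge and its singleton has no other vertex, so that the
   cylinder has no point besides its centre. *)
Lemma fin_cylinder_sink x u F S : path_of x = inr u -> sink_singleton u.2 ->
  fin_cylinder u F S `<=` [set x].
Proof.
move=> xE [v vs uv] y [[/= yE|[c [e [_ _ [eu _] _]]]]|[w [_ [uw _] yE]]].
- by apply: path_of_inj; rewrite xE yE.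
- have : (@src G @^-1` [set v]) e by move: eu; rewrite /emitted uv.
  by rewrite vs.
- apply: path_of_inj; rewrite xE yE (_ : [set w] = u.2); first by case: (u).
  by move: uw; rewrite uv => ->.
Qed.

Lemma X_sin_singleton b v : X_sin (b, [set v]) -> @sink_singleton G [set v].
Proof. by case=> _ [[_ /= vI]|//]; case: vI. Qed.

(** A cylinder that meets [x] in a point of [X_sin] over a singleton may be
   centred elsewhere and hence be unrelated to the [fin_cylinders_at u]; it
   contains one of them only because [x] is then isolated. *)
Lemma ultrapath_absorb x u D : path_of x = inr u ->
  cylinders G D -> D x -> exists2 N, fin_cylinders_at u N & N `<=` D.
Proof.
move=> xE CD Dx; have at0 := fin_cylinders_at0 u.
have isolated : sink_singleton u.2 ->
    exists2 N, fin_cylinders_at u N & N `<=` D.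
  move=> us; exists (fin_cylinder u set0 set0) => //.
  by move=> y /(fin_cylinder_sink xE us) ->.
case: (cylinders_inv CD Dx).
- move=> b e [h|[p A]]; rewrite xE // => -[uE] sD.
  exists (fin_cylinder u set0 set0) => //.
  apply: (subset_trans (@fin_cylinder_extensions _ _ _)).
  by apply: subset_trans sD; rewrite uE; exact: extensions_cat.
- move=> b A B; rewrite xE => -[uE] sAB ->.
  exists (fin_cylinder u set0 set0) => //.
  by rewrite uE; exact: fin_cylinder_subset_cylinder.
- by move=> u'; rewrite xE => -[<-] uD; exists D.
- move=> b v; rewrite xE => -[uE] /X_sin_singleton vs; apply: isolated.
  by rewrite uE.
Qed.

Lemma fin_cylinders_refine x u D1 D2 : path_of x = inr u ->
  cylinders G D1 -> cylinders G D2 -> D1 x -> D2 x ->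
  exists2 N, fin_cylinders_at u N & N `<=` D1 `&` D2.
Proof.
move=> xE C1 C2 x1 x2.
have [N1 u1 s1] := ultrapath_absorb xE C1 x1.
have [N2 u2 s2] := ultrapath_absorb xE C2 x2.
have [N uN sN] := fin_cylinders_at_refine u1 u2.
by exists N => // y /sN[/s1 ? /s2 ?].
Qed.

(** * Countability *)

(** Generic trees are countable, and closed under the two operations. Trees
   may also denote [set0], or intersections that are empty: only the inclusion
   [gen_vertex_ofP] holds, which suffices for countability. *)
Fixpoint gen_vertex_of (t : GenTree.tree (V + E)) : set V :=
  match t with
  | GenTree.Leaf (inl v) => [set v]
  | GenTree.Leaf (inr e) => rng e
  | GenTree.Node 0 [:: t1; t2] => gen_vertex_of t1 `|` gen_vertex_of t2
  | GenTree.Node _ [:: t1; t2] => gen_vertex_of t1 `&` gen_vertex_of t2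
  | _ => set0
  end.

Lemma gen_vertex_ofP : @gen_vertex G `<=` range gen_vertex_of.
Proof.
apply: smallest_sub; last first.
  by move=> A [[v _ <-]|[e _ <-]];
    [exists (GenTree.Leaf (inl v))|exists (GenTree.Leaf (inr e))].
split=> [A B [t _ <-] [s _ <-]|A B [t _ <-] [s _ <-] _].
- by exists (GenTree.Node 0 [:: t; s]).
- by exists (GenTree.Node 1 [:: t; s]).
Qed.

Definition cylinder_of
    (k : seq E * GenTree.tree (V + E) * option (seq E * seq V)) :
    set (boundary_space G) :=
  let u := (k.1.1, gen_vertex_of k.1.2) in
  if k.2 is Some (F, W) then fin_cylinder u [set` F] [set` W]
  else cylinder u.

Lemma countable_cylinders : countable (cylinders G).
Proof.
apply: (@sub_countable _ _ _ (range cylinder_of)); last first.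
  by apply: sub_countable (card_image_le _ _) _.
apply: subset_card_le => D [[[b B] [[_ /= BG _] _] <-]|].
  by have [t _ <-] := gen_vertex_ofP BG; exists (b, t, None).
move=> [[b B] [[_ /= BG _] _]].
have [t _ <-] := gen_vertex_ofP BG.
case=> [F0 [S0 [_ _ /finite_seqP[F ->] /finite_seqP[W ->] ->]]].
by exists (b, t, Some (F, W)).
Qed.

End UltragraphTheory.

(** * The topology of the boundary space *)

Theorem proposition3p16 (G : ultragraph) :
  countable (cylinders G) /\
  exists m : topology_on (boundary_space G),
    let X : topologicalType := topological_on m in
    [/\ @basis X (cylinders G),
        forall (x : X) (g : nat -> edge G),
          path_of x = inl g ->
          nbhs_basis x (initial_cylinders g) &
        forall (x : X) (u : seq (edge G) * set (vertex G)),
          path_of x = inr u ->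
          minimal_infinite_emitter u.2 \/ minimal_sink u.2 ->
          nbhs_basis x (fin_cylinders_at u)].
Proof.
split; first exact: countable_cylinders.
pose L (x : boundary_space G) := match path_of x with
  | inl g => initial_cylinders g
  | inr u => fin_cylinders_at u
  end.
have [||| m [Cb Lb]] := @topology_from_local_bases _ (cylinders G) L.
- rewrite /L => x N; case xE: (path_of x) => [g|u].
  + exact: initial_cylinders_sub.
  + exact: fin_cylinders_at_sub.
- rewrite /L => x; case xE: (path_of x) => [g|u].
  + by exists (cylinder (mkseq g 1, rng (g 0))); exists 1.
  + by exists (fin_cylinder u set0 set0); exact: fin_cylinders_at0.
- rewrite /L => x D1 D2; case xE: (path_of x) => [g|u].
  + exact: initial_cylinders_refine.
  + exact: fin_cylinders_refine.
by exists m; split=> // [x g xE|x u xE _]; have := Lb x;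
  rewrite /L (xE : path_of (x : boundary_space G) = _).
Qed.
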